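(* Consider the sparse linear Gaussian model: $S\in\{1,\dots,N\}$, $\mathcal{X}_S=\{\mathbf{x}\in\mathbb{R}^N:\|\mathbf{x}\|_0\le S\}$, $\mathbf{H}\in\mathbb{R}^{M\times N}$ with $\operatorname{spark}(\mathbf{H})>S$, $\sigma>0$, and observation $\mathbf{y}=\mathbf{H}\mathbf{x}+\mathbf{n}$ with $\mathbf{n}\sim\mathcal{N}(\mathbf{0},\sigma^2\mathbf{I})$, $\mathbf{x}\in\mathcal{X}_S$. Let $g:\mathcal{X}_S\to\mathbb{R}$ be a parameter function and $\mathbf{x}_0\in\mathcal{X}_S$. Let $D=\operatorname{rank}(\mathbf{H})$, let $\mathbf{H}=\mathbf{U}\mathbf{\Sigma}\mathbf{V}^T$ be a thin SVD ($\mathbf{U}\in\mathbb{R}^{M\times D}$, $\mathbf{V}\in\mathbb{R}^{N\times D}$ with orthonormal columns, $\mathbf{\Sigma}\in\mathbb{R}^{D\times D}$ diagonal with positive diagonal) and $\widetilde{\mathbf{H}}=\mathbf{V}\mathbf{\Sigma}^{-1}$. Then a bias function $c:\mathcal{X}_S\to\mathbb{R}$ is valid at $\mathbf{x}_0$ if and only if there exists a sequence $a\in\ell^2(\mathbb{Z}_+^D)$ such that for all $\mathbf{x}\in\mathcal{X}_S$ $$c(\mathbf{x})=\exp\Big(\tfrac{1}{2\sigma^2}\|\mathbf{H}\mathbf{x}_0\|_2^2-\tfrac{1}{\sigma^2}\mathbf{x}^T\mathbf{H}^T\mathbf{H}\mathbf{x}_0\Big)\sum_{\mathbf{p}\in\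mathbb{Z}_+^D}\frac{a[\mathbf{p}]}{\sqrt{\mathbf{p}!}}\Big(\tfrac{1}{\sigma}\widetilde{\mathbf{H}}^{\dagger}\mathbf{x}\Big)^{\mathbf{p}}-g(\mathbf{x}).$$
   Context: $\|\mathbf{x}\|_0$ = number of nonzero entries; $\operatorname{spark}$ = minimum number of linearly dependent columns; $\dagger$ denotes Moore–Penrose pseudoinverse. For a multi-index $\mathbf{p}\in\mathbb{Z}_+^D$: $\mathbf{p}!=\prod_l p_l!$, $\mathbf{z}^{\mathbf{p}}=\prod_l z_l^{p_l}$. An estimator is a function $\hat g:\mathbb{R}^M\to\mathbb{R}$; its bias is $b(\hat g;\mathbf{x})=\mathsf{E}_{\mathbf{x}}\{\hat g(\mathbf{y})\}-g(\mathbf{x})$ and variance $v(\hat g;\mathbf{x})=\mathsf{E}_{\mathbf{x}}\{(\hat g(\mathbf{y})-\mathsf{E}_{\mathbf{x}}\{\hat g(\mathbf{y})\})^2\}$, where $\mathsf{E}_{\mathbf{x}}$ is expectation under the density of $\mathbf{y}$ for parameter $\mathbf{x}$. A bias function $c$ is valid at $\mathbf{x}_0$ if there exists an estimator $\hat g$ with $v(\hat g;\mathbf{x}_0)<\infty$ and $b(\hat g;\mathbf{x})=c(\mathbf{x})$ for all $\mathbf{x}\in\mathcal{X}_S$. *)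

(* Defs.v *)
From HB Require Import structures.
From mathcomp Require Import all_boot all_order all_algebra.
From mathcomp Require Import all_classical all_reals all_analysis.
Set Implicit Arguments.
Unset Strict Implicit.
Unset Printing Implicit Defensive.
Import Order.TTheory GRing.Theory Num.Theory.
Local Open Scope classical_set_scope.
Local Open Scope ring_scope.

Section sparse_lgm.
Variable R : realType.

Definition l0norm n (x : 'cV[R]_n) : nat := #|[set i : 'I_n | x i 0 != 0]|.

Definition XS (N S : nat) : set 'cV[R]_N := [set x | (l0norm x <= S)%N].
Arguments XS N S : clear implicits.

Definition dep_cols M N (H : 'M[R]_(M, N)) (T : {set 'I_N}) : Prop :=
  exists c : 'cV[R]_N, [/\ c != 0, (forall i, i \notin T -> c i 0 = 0)
                        & H *m c = 0].

Definition spark_pred M N (H : 'M[R]_(M, N)) : pred nat :=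
  fun k => `[< exists T : {set 'I_N}, #|T| = k /\ dep_cols H T >].

(** spark H = minimum number of linearly dependent columns; if no set of
    columns is dependent we use the convention spark H = N+1 ("infinity"). *)
Definition spark M N (H : 'M[R]_(M, N)) : nat :=
  match pselect (exists k, spark_pred H k) with
  | left P => ex_minn P
  | right _ => N.+1
  end.

Definition penrose m n (A : 'M[R]_(m, n)) (X : 'M[R]_(n, m)) : Prop :=
  [/\ A *m X *m A = A, X *m A *m X = X,
      (A *m X)^T = A *m X & (X *m A)^T = X *m A].

Definition mpinv m n (A : 'M[R]_(m, n)) : 'M[R]_(n, m) :=
  xget 0 [set X | penrose A X].

(** Gaussian expectation.  The noise n ~ N(0, sigma^2 I_M) has independent
    N(0, sigma^2) coordinates; giter k integrates out coordinates k-1,...,0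
    (iterated integrals, i.e. integration against the product measure for
    nonnegative measurable integrands, by Tonelli). *)
Definition setcoord M (v : 'cV[R]_M) (k : nat) (t : R) : 'cV[R]_M :=
  \col_i (if (i : nat) == k then t else v i 0).

Fixpoint giter M (sigma : R) (k : nat) (F : 'cV[R]_M -> \bar R)
    (v : 'cV[R]_M) : \bar R :=
  match k with
  | 0 => F v
  | k'.+1 => (\int[normal_prob 0 sigma]_t giter sigma k' F (setcoord v k' t))%E
  end.

(** E_x { F(y) } for y = H x + n, F nonnegative *)
Definition gexp M N (H : 'M[R]_(M, N)) (sigma : R) (x : 'cV[R]_N)
    (F : 'cV[R]_M -> \bar R) : \bar R :=
  giter sigma M (fun n => F (H *m x + n)) 0.

Definition integrable_at M N (H : 'M[R]_(M, N)) sigma x (gh : 'cV[R]_M -> R)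
  : Prop := (gexp H sigma x (fun y => `|gh y|%:E) < +oo)%E.

(** E_x{ ghat(y) } (meaningful when integrable_at holds) *)
Definition gmean M N (H : 'M[R]_(M, N)) sigma x (gh : 'cV[R]_M -> R) : R :=
  fine (gexp H sigma x (fun y => (Num.max (gh y) 0)%:E))
  - fine (gexp H sigma x (fun y => (Num.max (- gh y) 0)%:E)).

Definition gvar M N (H : 'M[R]_(M, N)) sigma x (gh : 'cV[R]_M -> R) : \bar R :=
  gexp H sigma x (fun y => ((gh y - gmean H sigma x gh) ^+ 2)%:E).

Definition bias M N (H : 'M[R]_(M, N)) sigma (g : 'cV[R]_N -> R) x
    (gh : 'cV[R]_M -> R) : R := gmean H sigma x gh - g x.

Definition cV_borel M : set (set 'cV[R]_M) :=
  <<s [set A | exists (i : 'I_M) (B : set R),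
                 measurable B /\ A = (fun v : 'cV[R]_M => v i 0) @^-1` B] >>.

Definition estimator M (gh : 'cV[R]_M -> R) : Prop :=
  forall B : set R, measurable B -> cV_borel (gh @^-1` B).

Definition valid_bias M N (H : 'M[R]_(M, N)) sigma (S : nat)
    (g c : 'cV[R]_N -> R) (x0 : 'cV[R]_N) : Prop :=
  exists gh : 'cV[R]_M -> R,
    [/\ estimator gh, integrable_at H sigma x0 gh,
        (gvar H sigma x0 gh < +oo)%E
      & forall x, XS N S x ->
          integrable_at H sigma x gh /\ bias H sigma g x gh = c x].

Definition mindex (D : nat) := {ffun 'I_D -> nat}.

Definition mfact D (p : mindex D) : R := (\prod_i (p i)`!)%:R.

Definition mpow D (z : 'cV[R]_D) (p : mindex D) : R := \prod_i z i 0 ^+ p i.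

Definition l2seq D (a : mindex D -> R) : Prop :=
  (\esum_(p in [set: mindex D]) ((a p) ^+ 2)%:E < +oo)%E.

(** sum over Z_+^D of an (absolutely summable) family *)
Definition multisum D (f : mindex D -> R) : R :=
  fine (\esum_(p in [set: mindex D]) (Num.max (f p) 0)%:E)
  - fine (\esum_(p in [set: mindex D]) (Num.max (- f p) 0)%:E).

End sparse_lgm.
Arguments XS {R} N S.
Arguments mfact {R} [D] p.

(* Main.v *)
Require Import Defs.
From HB Require Import structures.
From mathcomp Require Import all_boot all_order all_algebra.
From mathcomp Require Import all_classical all_reals all_analysis.
From mathcomp Require Import measurable_realfun ring lra.
Set Implicit Arguments.
Unset Strict Implicit.
Unset Printing Implicit Defensive.
Import Order.TTheory GRing.Theory Num.Theory.
Import numFieldNormedType.Exports.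
Local Open Scope classical_set_scope.
Local Open Scope ring_scope.

(** Write [z = Sig V^T x / sigma], so that [<H x, H x'> / sigma^2 = <z, z'>].

    By the Cameron-Martin formula, the mean of an estimator [gh] at [x] is an
    explicit exponential factor times the pairing, in [L^2] of the noise law, of
    a recentred version of [gh] with [w_x n = exp (<n, H x> / sigma^2 -
    |H x|^2 / (2 sigma^2))]; the variance at [x0] is finite exactly when the
    recentred estimator is square integrable.  The functions [w_x] have Gram
    kernel [exp <z, z'>].  So do the sequences [p |-> z^p / sqrt p!] of [l^2].

    Which functions of [x] are pairings [x |-> <k, e_x>] with a fixed vector [k]
    depends only on the Gram kernel of the family [e_x]: they are the [F] with
    [(sum_i c_i F x_i)^2 <= C sum_ij c_i c_j K x_i x_j].  Comparing the two
    families gives the theorem. *)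

(** * Square-integrable functions *)

Section square_integrable.
Context d (T : measurableType d) (R : realType).
Variable mu : {measure set T -> \bar R}.
Implicit Types f g h : T -> R.

(** Genuine functions, not classes modulo almost-everywhere equality; convergence is expressed
    through [inner] of differences. *)
Definition sqintegrable f :=
  measurable_fun setT f /\ (\int[mu]_x ((f x) ^+ 2)%:E < +oo)%E.

Definition inner f g : R := \int[mu]_x (f x * g x).

Lemma sqintegrable_sqr f : sqintegrable f ->
  mu.-integrable setT (EFin \o (fun x => f x ^+ 2)).
Proof.
move=> [mf fy]; apply/integrableP; split.
  by apply/measurable_EFinP; exact: measurable_funX.
by under eq_integral do rewrite /= ger0_norm ?sqr_ge0//.
Qed.

Lemma sqintegrableM f g : sqintegrable f -> sqintegrable g ->
  mu.-integrable setT (EFin \o (fun x => f x * g x)).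
Proof.
move=> f2 g2; apply: (@le_integrable _ _ _ _ _ _ _
    (EFin \o (fun x => f x ^+ 2 + g x ^+ 2))) => //.
- by apply/measurable_EFinP; apply: measurable_funM; [case: f2|case: g2].
- move=> x _ /=; rewrite lee_fin [leRHS]ger0_norm ?addr_ge0 ?sqr_ge0//.
  by rewrite ler_norml; apply/andP; split; nra.
- exact: (integrableD measurableT (sqintegrable_sqr f2)
                      (sqintegrable_sqr g2)).
Qed.

Lemma sqintegrable_int_sqr f : measurable_fun setT f ->
  mu.-integrable setT (EFin \o (fun x => f x ^+ 2)) -> sqintegrable f.
Proof.
move=> mf /integrableP[_]; under eq_integral do rewrite /= ger0_norm ?sqr_ge0//.
by [].
Qed.

Lemma sqintegrable_lin a b f g : sqintegrable f -> sqintegrable g ->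
  sqintegrable (fun x => a * f x + b * g x).
Proof.
move=> f2 g2; have [mf _] := f2; have [mg _] := g2.
have mab : measurable_fun setT (fun x => a * f x + b * g x).
  by apply: measurable_funD; apply: measurable_funM.
apply: sqintegrable_int_sqr => //.
apply: (@le_integrable _ _ _ _ _ _ _
    (EFin \o (fun x => (2 * a ^+ 2) * f x ^+ 2 + (2 * b ^+ 2) * g x ^+ 2))) => //.
- by apply/measurable_EFinP; exact: measurable_funX.
- move=> x _ /=; rewrite lee_fin ger0_norm ?sqr_ge0// ger0_norm.
    by have := sqr_ge0 (a * f x - b * g x); nra.
  by have := sqr_ge0 (a * f x); have := sqr_ge0 (b * g x); rewrite !exprMn; nra.
- exact: (integrableD measurableT
    (integrableZl measurableT (2 * a ^+ 2) (sqintegrable_sqr f2))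
    (integrableZl measurableT (2 * b ^+ 2) (sqintegrable_sqr g2))).
Qed.

Lemma sqintegrable0 : sqintegrable (fun=> 0).
Proof.
split; first exact: measurable_cst.
under eq_integral do rewrite expr0n/=.
by rewrite integral0 ltry.
Qed.

Lemma innerC f g : inner f g = inner g f.
Proof. by apply: eq_Rintegral => x _; rewrite mulrC. Qed.

Lemma inner_ge0 f : 0 <= inner f f.
Proof. by apply: Rintegral_ge0 => x _; rewrite -expr2 sqr_ge0. Qed.

Lemma inner_linl a b f g h : sqintegrable f -> sqintegrable g ->
  sqintegrable h ->
  inner (fun x => a * f x + b * g x) h = a * inner f h + b * inner g h.
Proof.
move=> f2 g2 h2; have fh := sqintegrableM f2 h2.
have gh := sqintegrableM g2 h2.
rewrite /inner -!RintegralZl// -RintegralD//.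
- by apply: eq_Rintegral => x _; ring.
- exact: (integrableZl measurableT a fh).
- exact: (integrableZl measurableT b gh).
Qed.

Lemma inner_lin a b f g : sqintegrable f -> sqintegrable g ->
  inner (fun x => a * f x + b * g x) (fun x => a * f x + b * g x) =
  a ^+ 2 * inner f f + 2 * a * b * inner f g + b ^+ 2 * inner g g.
Proof.
move=> f2 g2; have fg2 := sqintegrable_lin a b f2 g2.
rewrite inner_linl// (innerC f) (innerC g) !inner_linl// (innerC g f); ring.
Qed.

Lemma cauchy_schwarz f g : sqintegrable f -> sqintegrable g ->
  inner f g ^+ 2 <= inner f f * inner g g.
Proof.
move=> f2 g2; have ff := inner_ge0 f; have gg := inner_ge0 g.
have q a b := inner_lin a b f2 g2.
have p a b : 0 <= a ^+ 2 * inner f f + 2 * a * b * inner f g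
    + b ^+ 2 * inner g g by rewrite -q inner_ge0.
move: ff; rewrite le_eqVlt => /predU1P[ff|ff].
  rewrite -ff mul0r; have [->|fg0] := eqVneq (inner f g) 0.
    by rewrite expr0n.
  (* If [inner f f = 0], the form with [b = 1] is affine in [a]; this [a] gives it the value
     [-(2 + inner g g) < 0], a contradiction. *)
  have := p (- (1 + inner g g) / inner f g) 1.
  rewrite -ff (_ : _ + _ = - (2 + inner g g)); last by field.
  lra.
(* The minimizing direction of the quadratic form, with denominators cleared. *)
have := p (- inner f g) (inner f f).
rewrite (_ : _ + _ = inner f f * (inner f f * inner g g - inner f g ^+ 2));
  last by ring.
by rewrite pmulr_rge0// subr_ge0.
Qed.

Lemma inner_fine f : sqintegrable f ->
  (inner f f)%:E = (\int[mu]_x ((f x) ^+ 2)%:E)%E.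
Proof.
move=> f2; rewrite /inner /Rintegral; under eq_integral do rewrite -expr2.
by rewrite fineK// integrable_fin_num//; exact: sqintegrable_sqr.
Qed.

(** Weighted Cauchy-Schwarz, with [sum_(j >= n) 2^-j = 2 / 2^n]. The induction peels off the first
    increment by [(a + b)^2 <= 2 a^2 + 2 b^2]; passing from [n] to [n + 1] absorbs the factor 2. *)
Lemma dyadic_telescope_sqr (v : nat -> R) m n :
  (v (n + m)%N - v n) ^+ 2 <= 2 / 2 ^+ n *
    \sum_(n <= j < n + m) 2 ^+ j * (v j.+1 - v j) ^+ 2.
Proof.
elim: m n => [|m IH] n.
  by rewrite addn0 subrr expr0n/= big_geq// mulr0.
rewrite addnS -addSn big_ltn ?ltn_addr// ?addSn ?ltnS ?leq_addr//.
have := IH n.+1; rewrite addSn [2 ^+ n.+1]exprS.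
set S := \sum_(_ <= _ < _) _ => H.
have p2 : 0 < (2 : R) ^+ n by rewrite exprn_gt0.
rewrite mulrDr mulrA divfK ?gt_eqF//.
have -> : 2 / 2 ^+ n * S = 2 * (2 / (2 * 2 ^+ n) * S).
  by field; rewrite gt_eqF.
move: H; set W := (2 / _ * S); set a := v (n + m).+1; set b := v n.+1 => H.
by have := sqr_ge0 ((a - b) - (b - v n)); nra.
Qed.

(** Completeness of [L^2] for rapidly converging sequences. Squared increments weighted by [2^j]
    still have integral at most [2^-j], so their sum [G] has integral at most 2, and [2 / 2^n * G]
    dominates every squared difference beyond [n]. *)
Lemma sqintegrable_complete (u : nat -> T -> R) :
  (forall n, sqintegrable (u n)) ->
  (forall n, inner (fun x => 1 * u n.+1 x + (-1) * u n x)
                   (fun x => 1 * u n.+1 x + (-1) * u n x) <= (4 ^+ n)^-1) ->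
  exists2 k, sqintegrable k & forall n,
    inner (fun x => 1 * k x + (-1) * u n x) (fun x => 1 * k x + (-1) * u n x)
      <= 4 / 2 ^+ n.
Proof.
move=> u2 du.
pose g j x : R := 2 ^+ j * (u j.+1 x - u j x) ^+ 2.
have g0 j x : 0 <= g j x by rewrite mulr_ge0 ?sqr_ge0// exprn_ge0.
have mu_ n : measurable_fun setT (u n) by case: (u2 n).
have mg j : measurable_fun setT (g j).
  by apply: measurable_funM => //; apply: measurable_funX; apply: measurable_funB.
(* The tail of [u] is controlled by [G] pointwise, even where [G] is infinite,
   so no null set has to be discarded. *)
pose G x := (\sum_(j <oo) (g j x)%:E)%E.
have mG : measurable_fun setT G.
  by apply: ge0_emeasurable_sum => // *; [rewrite lee_fin|apply/measurable_EFinP].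
have G0 x : (0 <= G x)%E by apply: nneseries_ge0 => *; rewrite lee_fin.
have iG : (\int[mu]_x G x <= 2%:E)%E.
  rewrite integral_nneseries//; last 2 first.
    by move=> *; apply/measurable_EFinP.
    by move=> *; rewrite lee_fin.
  have -> : 2%:E = (\sum_(j <oo) ((1 / 2 ^+ j)%:E : \bar R))%E.
    apply/esym/cvg_lim => //.
    rewrite (_ : (fun n => _) =
        EFin \o series (geometric (1:R) (2^-1))); last first.
      apply/funext => n /=; rewrite sumEFin; congr EFin.
      by apply: eq_bigr => i _; rewrite /= !mul1r exprVn.
    apply: cvg_EFin; first exact: nearW.
    have : series (geometric (1:R) 2^-1) @ \oo --> (1 / (1 - 2^-1) : R).
      by apply: cvg_geometric_series; rewrite ger0_norm ?invf_lt1// ltr1n.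
    by congr (_ --> _); field.
  apply: lee_nneseries => [j _ _|j _].
    by apply: integral_ge0 => *; rewrite lee_fin.
  have d2 := sqintegrable_lin 1 (-1) (u2 j.+1) (u2 j).
  apply: (@le_trans _ _ (2 ^+ j * inner (fun x => 1 * u j.+1 x + -1 * u j x)
      (fun x => 1 * u j.+1 x + -1 * u j x))%:E); last first.
    rewrite lee_fin (le_trans (ler_wpM2l _ (du j)))// ?exprn_ge0//.
    rewrite (_ : 4 = 2 * 2 :> R); last by ring.
    rewrite exprMn le_eqVlt; apply/predU1P; left.
    by field; rewrite expf_neq0.
  rewrite EFinM inner_fine// -ge0_integralZl//.
  - rewrite le_eqVlt; apply/predU1P; left; apply: eq_integral => x _.
    by rewrite -EFinM /g; congr EFin; ring.
  - by apply/measurable_EFinP; apply: measurable_funX; case: d2.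
  - by move=> *; rewrite lee_fin sqr_ge0.
have bnd x n m : (((u (n + m)%N x - u n x) ^+ 2)%:E <= (2 / 2 ^+ n)%:E * G x)%E.
  apply: (@le_trans _ _ ((2 / 2 ^+ n *
      \sum_(n <= j < n + m) g j x)%:E)).
    by rewrite lee_fin dyadic_telescope_sqr.
  rewrite EFinM lee_wpmul2l//.
  apply: (@le_trans _ _ (\sum_(0 <= j < n + m) (g j x)%:E)%E); last first.
    by apply: nneseries_lim_ge => *; rewrite lee_fin.
  rewrite sumEFin lee_fin [leRHS](@big_cat_nat _ _ _ n)//= ?leq_addr//.
  by rewrite lerDr sumr_ge0.
have cu x : (G x < +oo)%E -> cvgn (u ^~ x).
  move=> Gx; apply: cauchy_cvg; apply/cauchy_exP => e e0.
  have [r Gr] : exists r, G x = r%:E.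
    by exists (fine (G x)); rewrite fineK// ge0_fin_numE.
  have r0 : 0 <= r by rewrite -lee_fin -Gr.
  have : (fun n => 2^-1 ^+ n : R) @ \oo --> 0.
    by apply: cvg_expr; rewrite ger0_norm ?invf_lt1// ltr1n.
  (* The [+ 1] keeps the denominator positive when [r = 0]. *)
  move=> /cvgrPdist_lt/(_ (e ^+ 2 / (2 * r + 1)))[|n _ Hn].
    by rewrite divr_gt0 ?exprn_gt0// ltr_wpDl// mulr_ge0.
  exists (u n x); exists n => //= N nN.
  rewrite /ball/=; have := bnd x n (N - n)%N; rewrite subnKC// Gr lee_fin => H.
  rewrite distrC -ltr_sqr ?nnegrE// ?ltW// -normrX ger0_norm ?sqr_ge0//.
  apply: (le_lt_trans H); have := Hn n (leqnn n) => /=.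
  rewrite sub0r normrN ger0_norm ?exprn_ge0 ?invr_ge0// exprVn.
  rewrite ltr_pdivlMr; last by rewrite ltr_wpDl// mulr_ge0.
  have i2 : 0 < (2 ^+ n)^-1 :> R by rewrite invr_gt0 exprn_gt0.
  nra.
(* The default 0 is harmless: where [G] is infinite, the bound [kb] below is trivial. *)
pose k x := if (G x < +oo)%E then limn (u ^~ x) else 0.
have mA : measurable_fun setT (fun x => (G x < +oo)%E).
  by apply: measurable_fun_lte => //; exact: measurable_cst.
have mk : measurable_fun setT k.
  apply: (@measurable_fun_cvg _ _ _ _
    (fun n x => if (G x < +oo)%E then u n x else 0)) => //.
    by move=> n; apply: measurable_fun_ifT => //; exact: measurable_cst.
  move=> x _; rewrite /k; case: ifPn => Gx; last exact: cvg_cst.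
  exact: cu.
have kb n x : (((k x - u n x) ^+ 2)%:E <= (2 / 2 ^+ n)%:E * G x)%E.
  have [Gx|] := boolP (G x < +oo)%E; last first.
    rewrite ltey negbK => /eqP ->; rewrite gt0_muley ?leey//.
  have [r Gr] : exists r, G x = r%:E.
    by exists (fine (G x)); rewrite fineK// ge0_fin_numE.
  rewrite /k Gx Gr lee_fin.
  (* The bound [bnd] is uniform in [m], so it passes to the limit. *)
  have H : (fun m => (u (m + n)%N x - u n x) ^+ 2) @ \oo -->
      (limn (u ^~ x) - u n x) ^+ 2.
    have H0 : (fun m => u (m + n)%N x - u n x) @ \oo --> (limn (u ^~ x) - u n x).
      apply: cvgB; last exact: cvg_cst.
      by rewrite (cvg_shiftn n (u ^~ x)); exact: cu.
    by under eq_cvg do rewrite expr2; rewrite expr2; exact: cvgM.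
  rewrite -(cvg_lim _ H)//; apply: limr_le.
    by apply/cvg_ex; eexists; exact: H.
  by apply: nearW => m; rewrite -lee_fin addnC (le_trans (bnd _ _ _))// Gr.
have km n : measurable_fun setT (fun x => (((k x - u n x) ^+ 2)%:E)).
  by apply/measurable_EFinP; apply: measurable_funX; exact: measurable_funB.
have ikb n : (\int[mu]_x ((k x - u n x) ^+ 2)%:E <= (4 / 2 ^+ n)%:E)%E.
  apply: (@le_trans _ _ (\int[mu]_x ((2 / 2 ^+ n)%:E * G x))%E).
    apply: ge0_le_integral => //.
    - by move=> x _; rewrite lee_fin sqr_ge0.
    - by apply: measurable_funeM.
  rewrite ge0_integralZl//.
  rewrite (_ : 4 / 2 ^+ n = 2 / 2 ^+ n * 2); last by ring.
  by rewrite [leRHS]EFinM lee_wpmul2l.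
have kd2 : sqintegrable (fun x => k x - u 0%N x).
  split; first exact: measurable_funB.
  by rewrite (le_lt_trans (ikb 0%N))// ltry.
have k2 : sqintegrable k.
  rewrite (_ : k = fun x => 1 * (k x - u 0%N x) + 1 * u 0%N x).
    exact: sqintegrable_lin.
  by apply/funext => x; ring.
exists k => // n.
rewrite -lee_fin inner_fine; last exact: sqintegrable_lin.
rewrite (le_trans _ (ikb n))// le_eqVlt; apply/predU1P; left.
apply: eq_integral => x _.
by congr EFin; ring.
Qed.

End square_integrable.

(** * Functions represented by a Gram kernel *)

Section representer.
Context (R : realType) (Z : Type).
Implicit Types (s t : seq (R * Z)) (F : Z -> R) (K : Z -> Z -> R).

(** A list of pairs (coefficient, point) encodes a formal linear combination; points may repeat, so
    concatenation is addition. *)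
Definition lcomb F s : R := \sum_(p <- s) p.1 * F p.2.

Definition gram K s : R :=
  \sum_(p <- s) \sum_(q <- s) p.1 * q.1 * K p.2 q.2.

Definition scale_comb (a : R) s := [seq (a * p.1, p.2) | p <- s].

Lemma lcomb_lin F a b s t :
  lcomb F (scale_comb a s ++ scale_comb b t) = a * lcomb F s + b * lcomb F t.
Proof.
rewrite /lcomb big_cat !big_map !big_distrr/=.
by congr (_ + _); apply: eq_bigr => p _; rewrite mulrA.
Qed.

Context d (T : measurableType d) (mu : {measure set T -> \bar R}).
Variable e : Z -> T -> R.
Hypothesis e2 : forall z, sqintegrable mu (e z).

Let comb s x := lcomb (e ^~ x) s.

Lemma sqintegrable_comb s : sqintegrable mu (comb s).
Proof.
elim: s => [|p s IH].
  rewrite (_ : comb [::] = fun=> 0); first exact: sqintegrable0.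
  by apply/funext => x; rewrite /comb /lcomb big_nil.
rewrite (_ : comb (p :: s) = fun x => p.1 * e p.2 x + 1 * comb s x).
  exact: sqintegrable_lin.
by apply/funext => x; rewrite /comb /lcomb big_cons mul1r.
Qed.

Lemma inner_comb k s : sqintegrable mu k ->
  inner mu (comb s) k = lcomb (fun z => inner mu (e z) k) s.
Proof.
move=> k2; elim: s => [|p s IH].
  rewrite /lcomb big_nil /inner -[RHS](mul0r (fine (mu setT))) -Rintegral_cst//.
  by apply: eq_Rintegral => x _; rewrite /comb /lcomb big_nil mul0r.
rewrite (_ : comb (p :: s) = fun x => p.1 * e p.2 x + 1 * comb s x).
  rewrite inner_linl//; last exact: sqintegrable_comb.
  by rewrite IH /lcomb big_cons mul1r.
by apply/funext => x; rewrite /comb /lcomb big_cons mul1r.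
Qed.

Variable K : Z -> Z -> R.
Hypothesis eK : forall z z', inner mu (e z) (e z') = K z z'.

Lemma inner_comb_gram s : inner mu (comb s) (comb s) = gram K s.
Proof.
rewrite inner_comb; last exact: sqintegrable_comb.
apply: eq_bigr => p _; rewrite innerC inner_comb// big_distrr/=.
by apply: eq_bigr => q _; rewrite innerC eK mulrA.
Qed.

(* [k] is the limit of combinations that almost maximize
   [2 * lcomb F s - gram K s]: the parallelogram law makes such combinations
   Cauchy, and perturbing them along [e z] gives the reproducing identity. *)
Theorem representer F :
  (exists2 k, sqintegrable mu k & forall z, F z = inner mu k (e z)) <->
  exists C, forall s, lcomb F s ^+ 2 <= C * gram K s.
Proof.
split=> [[k k2 Fk]|[C FC]].
  exists (inner mu k k) => s.
  have -> : lcomb F s = inner mu (comb s) k.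
    by rewrite inner_comb//; apply: eq_bigr => p _; rewrite Fk innerC.
  rewrite -inner_comb_gram mulrC cauchy_schwarz//; exact: sqintegrable_comb.
have c2 := sqintegrable_comb.
have gram0 s : 0 <= gram K s by rewrite -inner_comb_gram inner_ge0.
pose J s := 2 * lcomb F s - gram K s.
(* From [l^2 <= c q] follows [2 l <= c + q] by the arithmetic-geometric mean inequality. *)
have JC s : J s <= `|C|.
  have := FC s; have := gram0 s; rewrite /J; have := ler_norm C.
  have := normr_ge0 C; set c := `|C|; set l := lcomb F s; set q := gram K s.
  move=> c0 Cc q0 lq'; have lq : l ^+ 2 <= c * q.
    by rewrite (le_trans lq')// ler_wpM2r.
  rewrite lerBlDr; have [l0|l0] := lerP l 0.
    by rewrite (@le_trans _ _ 0)// ?addr_ge0// mulr_ge0_le0.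
  rewrite -ler_sqr ?nnegrE ?addr_ge0 ?mulr_ge0 ?(ltW l0)//.
  by have := sqr_ge0 (c - q); nra.
have [S_ HS] : {S_ : nat -> seq (R * Z) &
    forall n t, J t <= J (S_ n) + (4 ^+ n.+1)^-1}.
  apply: (@choice _ _ (fun n s => forall t, J t <= J s + (4 ^+ n.+1)^-1)) => n.
  have supJ : has_sup (range J).
    split; first by exists (J [::]); exists [::].
    by exists `|C| => _ [s _ <-].
  have e0 : 0 < (4 ^+ n.+1 : R)^-1 by rewrite invr_gt0 exprn_gt0.
  have [_ [s _ <-] Js] := sup_adherent e0 supJ.
  exists s => t; rewrite -lerBlDr; apply: le_trans (ltW Js).
  by rewrite lerD2r; apply: ub_le_sup; [case: supJ|exists t].
have combl a b s t : comb (scale_comb a s ++ scale_comb b t) =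
    fun x => a * comb s x + b * comb t x.
  by apply/funext => x; rewrite /comb lcomb_lin.
have graml a b s t : gram K (scale_comb a s ++ scale_comb b t) =
    a ^+ 2 * gram K s + 2 * a * b * inner mu (comb s) (comb t)
    + b ^+ 2 * gram K t.
  by rewrite -!inner_comb_gram combl inner_lin.
have cau n : inner mu
    (fun x => 1 * comb (S_ n.+1) x + (-1) * comb (S_ n) x)
    (fun x => 1 * comb (S_ n.+1) x + (-1) * comb (S_ n) x) <= (4 ^+ n)^-1.
  rewrite inner_lin// !inner_comb_gram.
  set s := S_ n.+1; set t := S_ n.
  (* The midpoint of [s] and [t] is tested against the near-optimality of both: there [J] exceeds
     the mean of [J s] and [J t] by a quarter of the squared distance. *)
  have := HS n (scale_comb 2^-1 s ++ scale_comb 2^-1 t).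
  have := HS n.+1 (scale_comb 2^-1 s ++ scale_comb 2^-1 t).
  rewrite -/s -/t /J lcomb_lin graml !exprS.
  have : 0 < (4 ^+ n : R)^-1 by rewrite invr_gt0 exprn_gt0.
  rewrite !invfM; set w := (4 ^+ n)^-1.
  set i := inner _ _ _; set a := gram K s; set b := gram K t.
  set l := lcomb F s; set m := lcomb F t; lra.
have [k k2 Hk] := sqintegrable_complete (fun n => c2 (S_ n)) cau.
exists k => // z.
set kz := inner mu k (e z).
have K0 : 0 <= K z z by rewrite -eK inner_ge0.
(* Two errors are added through [(a + b)^2 <= 2 a^2 + 2 b^2]: the defect [w] of the [n]-th
   combination and its distance to [k]. *)
have main n : (F z - kz) ^+ 2 <= (2 * (K z z + 1) + 8 * K z z) / 2 ^+ n.
  set w := F z - inner mu (comb (S_ n)) (e z).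
  have w1 : w ^+ 2 <= (4 ^+ n.+1)^-1 * (K z z + 1).
    (* Moving by [t] along [e z] changes [J] by [2 t w - t^2 K z z], which near-optimality bounds.
       The optimal step is [w / K z z]; the [+ 1] avoids a zero denominator. *)
    pose t := w / (K z z + 1).
    have := HS n (scale_comb 1 (S_ n) ++ scale_comb t [:: (1, z)]).
    rewrite /J lcomb_lin graml.
    have -> : lcomb F [:: (1, z)] = F z by rewrite /lcomb big_seq1 mul1r.
    have -> : gram K [:: (1, z)] = K z z by rewrite /gram !big_seq1/= !mul1r.
    have -> : comb [:: (1, z)] = e z.
      by apply/funext => x; rewrite /comb /lcomb big_seq1 mul1r.
    set E := (4 ^+ _)^-1; set g := gram _ _; set l := lcomb _ _.
    have -> : inner mu (comb (S_ n)) (e z) = F z - w by rewrite /w; ring.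
    have tw : t * (K z z + 1) = w by rewrite /t divfK// gt_eqF// ltr_wpDl.
    rewrite -tw; move=> H.
    have {}H : 2 * t ^+ 2 * (K z z + 1) - t ^+ 2 * K z z <= E by lra.
    rewrite exprMn expr2 mulrA ler_wpM2r//; first lra.
    by have := sqr_ge0 t; nra.
  have w2 : (inner mu (comb (S_ n)) (e z) - kz) ^+ 2 <= 4 / 2 ^+ n * K z z.
    have d2 := sqintegrable_lin 1 (-1) k2 (c2 (S_ n)).
    have := cauchy_schwarz d2 (e2 z).
    rewrite inner_linl// -/kz eK => H.
    have -> : inner mu (comb (S_ n)) (e z) - kz =
        - (1 * kz + -1 * inner mu (comb (S_ n)) (e z)) by ring.
    by rewrite sqrrN (le_trans H)// ler_wpM2r// Hk.
  have p2 : 1 <= (2 : R) ^+ n by rewrite exprn_ege1// ler1n.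
  have w3 : (4 ^+ n.+1)^-1 <= (2 ^+ n)^-1 :> R.
    rewrite lef_pV2 ?posrE ?exprn_gt0// exprS.
    rewrite (_ : 4 ^+ n = 2 ^+ n * 2 ^+ n :> R); last first.
      by rewrite -exprMn; congr (_ ^+ n); ring.
    nra.
  have i2 : 0 < (2 ^+ n : R)^-1 by rewrite invr_gt0 exprn_gt0.
  have {w3}w1 : w ^+ 2 <= (2 ^+ n)^-1 * (K z z + 1).
    by rewrite (le_trans w1)// ler_wpM2r// addr_ge0.
  rewrite (_ : F z - kz = w + (inner mu (comb (S_ n)) (e z) - kz)); last first.
    by rewrite /w; ring.
  move: w1 w2; set a := w; set b := inner _ _ _ - _ => w1 w2.
  by have := sqr_ge0 (a - b); nra.
have lim0 : (fun n => (2 * (K z z + 1) + 8 * K z z) / 2 ^+ n) @ \oo --> (0 : R).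
  rewrite -[X in _ --> X](mulr0 (2 * (K z z + 1) + 8 * K z z)).
  apply: cvgM; first exact: cvg_cst.
  under eq_cvg do rewrite -exprVn.
  by apply: cvg_expr; rewrite ger0_norm ?invf_lt1// ltr1n.
have : (F z - kz) ^+ 2 <= 0.
  rewrite -(cvg_lim _ lim0)//; apply: limr_ge; last exact: nearW.
  by apply/cvg_ex; eexists; exact: lim0.
by rewrite exprn_even_le0//= subr_eq0 => /eqP.
Qed.

End representer.

(** * The Gaussian noise law *)

Section gaussian_line.
Variable R : realType.
Local Notation leb := (@lebesgue_measure R).

(** The Radon-Nikodym derivative and the Gaussian density have the same integral over every
    measurable set, hence agree almost everywhere. *)
Lemma ge0_integral_normal_prob (m s : R) (f : R -> \bar R) :
  measurable_fun setT f -> (forall x, 0 <= f x)%E ->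
  (\int[normal_prob m s]_x f x =
   \int[leb]_x (f x * (normal_pdf m s x)%:E))%E.
Proof.
move=> mf f0; have dom := @normal_prob_dominates R m s.
rewrite -(Radon_Nikodym_SigmaFinite.change_of_variables dom f0)//.
have mpdf : measurable_fun setT (EFin \o normal_pdf m s).
  by apply/measurable_EFinP; exact: measurable_normal_pdf.
have mRN : measurable_fun setT
    (Radon_Nikodym_SigmaFinite.f (normal_prob m s) leb).
  by apply: measurable_int (Radon_Nikodym_SigmaFinite.f_integrable dom).
apply: ae_eq_integral => //; try exact: emeasurable_funM.
apply: ae_eqe_mul2l; apply: integral_ae_eq => //.
  exact: Radon_Nikodym_SigmaFinite.f_integrable.
by move=> A _ mA; rewrite -Radon_Nikodym_SigmaFinite.f_integral.
Qed.

(** The translated measure gives half-open intervals their length, which characterizes Lebesgue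
    measure. *)
Lemma lebesgue_measure_shift (a : R) (A : set R) : measurable A ->
  pushforward leb ((fun x => a + x) : _ -> measurableTypeR R) A = leb A.
Proof.
have ms : measurable_fun setT ((fun x => a + x) : R -> measurableTypeR R).
  by apply: measurable_funD.
pose X : {mfun R >-> measurableTypeR R} :=
  HB.pack (fun x => a + x) (isMeasurableFun.Build _ _ _ _ _ ms).
move=> mA; apply/esym.
apply: (@lebesgue_measure_unique R (pushforward leb X)) => //= _ [[u v]] _ <-.
rewrite /pushforward.
have -> : X @^-1` `]u, v]%classic = `]u - a, v - a]%classic.
  apply/seteqP; split=> x /=; rewrite !in_itv/= => /andP[] ? ?;
    by apply/andP; split; lra.
by rewrite !lebesgue_measure_itv/= !lte_fin ltrD2r -!EFinB; case: ifP => // _;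
  congr EFin; ring.
Qed.

Lemma ge0_integral_lebesgue_shift (a : R) (f : R -> \bar R) :
  measurable_fun setT f -> (forall x, 0 <= f x)%E ->
  (\int[leb]_x f (a + x)%R = \int[leb]_x f x)%E.
Proof.
move=> mf f0.
have ms : measurable_fun setT ((fun x => a + x) : R -> measurableTypeR R).
  by apply: measurable_funD.
pose X : {mfun R >-> measurableTypeR R} :=
  HB.pack (fun x => a + x) (isMeasurableFun.Build _ _ _ _ _ ms).
transitivity (\int[pushforward leb X]_x f x)%E.
  by rewrite ge0_integral_pushforward.
by apply: eq_measure_integral => A mA _; exact: lebesgue_measure_shift.
Qed.

(** One-dimensional Cameron-Martin formula: translation moves the shift onto the density, and
    [x^2 - (x - a)^2 = 2 x a - a^2] gives the exponent. *)
Lemma normal_prob_shift (s a : R) (f : R -> \bar R) : s != 0 ->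
  measurable_fun setT f -> (forall x, 0 <= f x)%E ->
  (\int[normal_prob 0 s]_x f (a + x)%R =
   \int[normal_prob 0 s]_x
     (f x * (expR (x * a / s ^+ 2 - a ^+ 2 / (2 * s ^+ 2)))%:E))%E.
Proof.
move=> s0 mf f0.
have mw : measurable_fun setT
    (fun x : R => expR (x * a / s ^+ 2 - a ^+ 2 / (2 * s ^+ 2))).
  apply: measurableT_comp => //; apply: measurable_funB => //.
  by do 2 apply: measurable_funM => //.
have ma : measurable_fun setT (fun x : R => a + x) by apply: measurable_funD.
rewrite !ge0_integral_normal_prob//; last 3 first.
- apply: emeasurable_funM => //; exact/measurable_EFinP.
- by move=> x; rewrite mule_ge0// lee_fin expR_ge0.
- exact: (measurableT_comp mf ma).
pose h x := (f x * (normal_pdf 0 s (x - a))%:E)%E.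
transitivity (\int[leb]_x h (a + x)%R)%E.
  by apply: eq_integral => x _; rewrite /h (_ : a + x - a = x)//; ring.
rewrite ge0_integral_lebesgue_shift//; last 2 first.
- apply: emeasurable_funM => //; apply/measurable_EFinP.
  apply: (measurableT_comp (measurable_normal_pdf 0 s)).
  exact: measurable_funB.
- by move=> x; rewrite mule_ge0// lee_fin normal_pdf_ge0.
apply: eq_integral => x _; rewrite /h -muleA; congr (_ * _)%E.
rewrite -EFinM; congr EFin; rewrite !normal_pdfE// mulrCA; congr (_ * _).
by rewrite /normal_fun -expRD; congr expR; field.
Qed.

End gaussian_line.

(** * Iterated Gaussian integrals as integrals against a law on column vectors *)

Section gaussian_vector.
Variables (R : realType) (M : nat).

(** The generators of [cV_borel], named so that column vectors become a measurable type with that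
    sigma-algebra. *)
Definition cV_cylinder : set (set 'cV[R]_M) :=
  [set A | exists (i : 'I_M) (B : set R),
     measurable B /\ A = (fun v : 'cV[R]_M => v i 0) @^-1` B].

Local Notation cVm := (g_sigma_algebraType cV_cylinder).

Lemma measurable_coord (i : 'I_M) :
  measurable_fun setT (fun v : cVm => (v : 'cV[R]_M) i 0).
Proof.
by move=> _ B mB; rewrite setTI; apply: sub_sigma_algebra; exists i, B.
Qed.

Lemma measurable_cV d (T : measurableType d) (f : T -> cVm) :
  (forall i, measurable_fun setT (fun x => (f x : 'cV[R]_M) i 0)) ->
  measurable_fun setT f.
Proof.
move=> mf; apply: (@measurability _ _ T cVm setT f cV_cylinder) => //.
by move=> _ [_ [i [B [mB ->]]] <-]; exact: mf.
Qed.

Lemma measurable_setcoord k :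
  measurable_fun setT (fun vt : cVm * measurableTypeR R =>
    (setcoord (vt.1 : 'cV[R]_M) k vt.2 : cVm)).
Proof.
apply: measurable_cV => i; under eq_fun do rewrite mxE.
case: eqP => _; first exact: measurable_snd.
exact: (measurableT_comp (measurable_coord i) measurable_fst).
Qed.

Lemma measurable_setcoordl k (t : R) :
  measurable_fun setT (fun v : cVm => (setcoord (v : 'cV[R]_M) k t : cVm)).
Proof.
apply: measurable_cV => i; under eq_fun do rewrite mxE.
case: eqP => _; [exact: measurable_cst|exact: measurable_coord].
Qed.

Lemma setcoordC (v : 'cV[R]_M) j k s t : j != k ->
  setcoord (setcoord v j s) k t = setcoord (setcoord v k t) j s.
Proof.
move=> jk; apply/matrixP => i l; rewrite !mxE.
have [->|//] := eqVneq (i : nat) k; first by rewrite eq_sym (negbTE jk).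
Qed.

Variable sigma : R.
Hypothesis sigma_gt0 : 0 < sigma.

(** The iterated integral overwrites only coordinates below [k], so assigning coordinate [j]
    commutes with it. *)
Lemma giter_setcoord k j t (F : 'cV[R]_M -> \bar R) v : (k <= j)%N ->
  giter sigma k F (setcoord v j t) =
  giter sigma k (fun u => F (setcoord u j t)) v.
Proof.
elim: k v => [//|k IH] v kj /=.
apply: eq_integral => s _; rewrite -IH ?(ltnW kj)//.
by rewrite setcoordC// gtn_eqF.
Qed.

(** Logarithm of the Cameron-Martin density for the shift by [trunc k m]. *)
Definition tiltexp k (m n : 'cV[R]_M) : R :=
  \sum_(i < M | (i < k)%N)
    (n i 0 * m i 0 / sigma ^+ 2 - m i 0 ^+ 2 / (2 * sigma ^+ 2)).

Definition trunc k (m : 'cV[R]_M) : 'cV[R]_M :=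
  \col_i (if (i < k)%N then m i 0 else 0).

Lemma measurable_expR_tiltexp k m :
  measurable_fun setT (fun n : cVm => expR (tiltexp k m n)).
Proof.
apply: measurableT_comp => //; rewrite /tiltexp.
under eq_fun do rewrite big_mkcond/=; apply: measurable_sum => i.
case: (i < k)%N => /=; last exact: measurable_cst.
apply: measurable_funB => //; do 2 apply: measurable_funM => //.
exact: measurable_coord.
Qed.

Lemma measurable_addl (m : 'cV[R]_M) :
  measurable_fun setT (fun n : cVm => (m + (n : 'cV[R]_M) : cVm)).
Proof.
apply: measurable_cV => i; under eq_fun do rewrite mxE.
by apply: measurable_funD => //; exact: measurable_coord.
Qed.

Lemma tiltexpS (i : 'I_M) m n t :
  tiltexp i.+1 m (setcoord n i t) =
  tiltexp i m n + (t * m i 0 / sigma ^+ 2 - m i 0 ^+ 2 / (2 * sigma ^+ 2)).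
Proof.
rewrite /tiltexp (bigD1 i)//= addrC; congr (_ + _); last by rewrite mxE eqxx.
apply: eq_big => [j|j]; first by rewrite ltnS ltn_neqAle andbC.
by case/andP => _ ji; rewrite mxE (negbTE (ji : (j : nat) != i)).
Qed.

Lemma truncS (i : 'I_M) m n t :
  trunc i.+1 m + setcoord n i t = setcoord (trunc i m + n) i (m i 0 + t).
Proof.
apply/matrixP => j l; rewrite !mxE ltnS.
have [ji|ji] := eqVneq (j : nat) i; first by rewrite (ord_inj ji) leqnn.
by rewrite leq_eqVlt (negbTE ji).
Qed.

(* The second conjunct is the Cameron-Martin formula; it is carried through the
   induction because each step only shifts one coordinate. *)
Lemma giter_measure k : (k <= M)%N ->
  exists P : probability cVm R, forall F : cVm -> \bar R,
    measurable_fun setT F -> (forall v, 0 <= F v)%E ->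
    (giter sigma k F 0 = \int[P]_n F n)%E /\
    forall m : 'cV[R]_M,
      (\int[P]_n F (trunc k m + (n : 'cV[R]_M))%R =
       \int[P]_n (F n * (expR (tiltexp k m n))%:E))%E.
Proof.
elim: k => [_|k IH kM].
  (* With no coordinate integrated out, the law is the point mass at the base vector 0. *)
  exists (dirac (0 : cVm)) => F mF F0; split.
    by rewrite integral_dirac// diracT mul1e.
  move=> m; have ma := measurable_addl (trunc 0 m).
  rewrite !integral_dirac//; last 2 first.
  - apply: emeasurable_funM => //; apply/measurable_EFinP.
    exact: measurable_expR_tiltexp.
  - exact: (measurableT_comp mF ma).
  rewrite !diracT !mul1e /tiltexp big_pred0// expR0 mule1 addr0.
  by congr F; apply/matrixP => i j; rewrite !mxE.
have [P PE] := IH (ltnW kM).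
pose i := Ordinal kM.
pose X : {mfun (cVm * measurableTypeR R)%type >-> cVm} :=
  HB.pack (fun vt : cVm * measurableTypeR R =>
    (setcoord (vt.1 : 'cV[R]_M) k vt.2 : cVm))
    (isMeasurableFun.Build _ _ _ _ _ (measurable_setcoord k)).
(* The next law draws coordinate [k] independently and writes it into the vector. *)
pose PN : probability _ R := (P \x normal_prob 0 sigma)%E.
pose Q : probability cVm R := distribution PN X.
have QE (F : cVm -> \bar R) : measurable_fun setT F -> (forall v, 0 <= F v)%E ->
    (\int[Q]_n F n =
     \int[normal_prob 0 sigma]_t \int[P]_v F (setcoord (v : 'cV[R]_M) k t))%E.
  move=> mF F0; rewrite ge0_integral_distribution//.
  rewrite fubini_tonelli2//; first exact: measurableT_comp.
  by move=> x; exact: F0.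
exists Q => F mF F0.
have mFs t : measurable_fun setT
    (fun v : cVm => F (setcoord (v : 'cV[R]_M) k t)).
  exact: (measurableT_comp mF (measurable_setcoordl k t)).
split.
  rewrite QE//=; apply: eq_integral => t _.
  rewrite giter_setcoord//.
  by have [-> _] := PE _ (mFs t) (fun v => F0 _).
move=> m.
have mw := measurable_expR_tiltexp k m.
have mw' := measurable_expR_tiltexp k.+1 m.
rewrite !QE//; last 3 first.
- by apply: emeasurable_funM => //; exact/measurable_EFinP.
- by move=> v; rewrite mule_ge0// lee_fin expR_ge0.
- exact: (measurableT_comp mF (measurable_addl (trunc k.+1 m))).
pose f t := (\int[P]_v (F (setcoord (v : 'cV[R]_M) k t) *
  (expR (tiltexp k m v))%:E))%E.
have f0 t : (0 <= f t)%E.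
  by apply: integral_ge0 => v _; rewrite mule_ge0// lee_fin expR_ge0.
have mf : measurable_fun setT f.
  apply: (measurable_fun_fubini_tonelli_G (m1 := P)
    (fun vt : cVm * measurableTypeR R =>
     (F (setcoord (vt.1 : 'cV[R]_M) k vt.2) * (expR (tiltexp k m vt.1))%:E)%E)).
  - apply: emeasurable_funM.
      exact: (measurableT_comp mF (measurable_setcoord k)).
    apply/measurable_EFinP.
    exact: (measurableT_comp mw measurable_fst).
  - by move=> v; rewrite mule_ge0// lee_fin expR_ge0.
(* The induction hypothesis shifts the coordinates below [k]; the one-dimensional formula then
   shifts coordinate [k], and the exponents add up. *)
transitivity (\int[normal_prob 0 sigma]_t f (m i 0 + t)%R)%E.
  apply: eq_integral => t _; rewrite /f.
  have [_ /(_ m) <-] := PE _ (mFs (m i 0 + t)) (fun v => F0 _).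
  by apply: eq_integral => v _; rewrite (truncS i).
rewrite normal_prob_shift ?gt_eqF//; apply: eq_integral => t _.
rewrite muleC /f -ge0_integralZl//; last 2 first.
- by apply: emeasurable_funM => //; exact/measurable_EFinP.
- by move=> v _; rewrite mule_ge0// lee_fin expR_ge0.
apply: eq_integral => v _.
by rewrite muleC -muleA -EFinM -expRD -(tiltexpS i).
Qed.

End gaussian_vector.

(** * Bias functions as pairings *)

Notation cVm R M := (g_sigma_algebraType (@cV_cylinder R M)).

Section dot.
Variables (R : realType) (M : nat).
Implicit Types u v w : 'cV[R]_M.

Definition dot u v : R := (u^T *m v) 0 0.

Lemma dotE u v : dot u v = \sum_i u i 0 * v i 0.
Proof. by rewrite /dot mxE; apply: eq_bigr => i _; rewrite mxE. Qed.

Lemma dotC u v : dot u v = dot v u.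
Proof. by rewrite !dotE; apply: eq_bigr => i _; rewrite mulrC. Qed.

Lemma dotDl u v w : dot (u + v) w = dot u w + dot v w.
Proof. by rewrite /dot linearD mulmxDl mxE. Qed.

Lemma dotDr u v w : dot w (u + v) = dot w u + dot w v.
Proof. by rewrite !(dotC w) dotDl. Qed.

End dot.

Section posneg.
Context d (T : measurableType d) (R : realType).
Variable mu : {measure set T -> \bar R}.

(** Links the differences of positive and negative parts in [gmean] and [multisum] to ordinary
    integrals. *)
Lemma Rintegral_maxB (f : T -> R) : mu.-integrable setT (EFin \o f) ->
  fine (\int[mu]_x (Num.max (f x) 0)%:E)%E
  - fine (\int[mu]_x (Num.max (- f x) 0)%:E)%E = \int[mu]_x f x.
Proof.
move=> intf; rewrite /Rintegral [in RHS]integralE.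
have -> : (\int[mu]_x (Num.max (f x) 0)%:E =
    \int[mu]_x (fun x => (f x)%:E)^\+ x)%E.
  by apply: eq_integral => x _; rewrite funeposE EFin_max.
have -> : (\int[mu]_x (Num.max (- f x) 0)%:E =
    \int[mu]_x (fun x => (f x)%:E)^\- x)%E.
  by apply: eq_integral => x _; rewrite funenegE EFin_max EFinN.
rewrite [RHS]fineB//; first exact: (integrable_pos_fin_num measurableT intf).
exact: (integrable_neg_fin_num measurableT intf).
Qed.

End posneg.

(** * Means and variances of estimators under the shifted noise law *)

Section gaussian_estimation.
Variables (R : realType) (M N : nat) (H : 'M[R]_(M, N)) (sigma : R).
Hypothesis sigma_gt0 : 0 < sigma.

(** Density of the noise law shifted by [m] with respect to the noise law. *)
Definition tilt (m n : 'cV[R]_M) : R :=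
  expR (dot n m / sigma ^+ 2 - dot m m / (2 * sigma ^+ 2)).

Lemma tiltexpE m n : expR (tiltexp sigma M m n) = tilt m n.
Proof.
congr expR; rewrite /tiltexp !dotE !big_distrl/= -sumrB.
by apply: eq_big => i; rewrite ?ltn_ord// => _; rewrite -expr2.
Qed.

Lemma giter_gaussian : exists P : probability (cVm R M) R,
  forall F : cVm R M -> \bar R,
    measurable_fun setT F -> (forall v, 0 <= F v)%E ->
    (giter sigma M F 0 = \int[P]_n F n)%E /\
    forall m : 'cV[R]_M,
      (\int[P]_n F (m + (n : 'cV[R]_M))%R =
       \int[P]_n (F n * (tilt m n)%:E))%E.
Proof.
have [P PE] := giter_measure sigma_gt0 (leqnn M).
exists P => F mF F0; have [-> /= HF] := PE F mF F0; split=> // m.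
transitivity (\int[P]_n F (trunc M m + (n : 'cV[R]_M))%R)%E.
  apply: eq_integral => n _; congr (F (_ + _)).
  by apply/matrixP => i j; rewrite mxE ltn_ord (ord1 j).
by rewrite HF; apply: eq_integral => n _; rewrite tiltexpE.
Qed.

Variable P : probability (cVm R M) R.
Hypothesis PE : forall F : cVm R M -> \bar R,
    measurable_fun setT F -> (forall v, 0 <= F v)%E ->
    (giter sigma M F 0 = \int[P]_n F n)%E /\
    forall m : 'cV[R]_M,
      (\int[P]_n F (m + (n : 'cV[R]_M))%R =
       \int[P]_n (F n * (tilt m n)%:E))%E.

Lemma measurable_tilt m : measurable_fun setT (fun n : cVm R M => tilt m n).
Proof.
under eq_fun do rewrite -tiltexpE; exact: measurable_expR_tiltexp.
Qed.

Lemma tiltD (m m' n : 'cV[R]_M) :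
  tilt m n * tilt m' n = expR (dot m m' / sigma ^+ 2) * tilt (m + m') n.
Proof.
rewrite /tilt -!expRD; congr expR; rewrite !dotDr !dotDl (dotC m' m).
by field; rewrite gt_eqF.
Qed.

(** The shift formula applied to the constant 1. *)
Lemma integral_tilt m : (\int[P]_n (tilt m n)%:E = 1)%E.
Proof.
have [_ /(_ m)] := PE (measurable_cst 1%E) (fun _ => lee01).
rewrite /cst integral_cst// mul1e => tilt1.
transitivity (P setT); last exact: probability_setT.
by rewrite tilt1; apply: eq_integral => n _; rewrite mul1e.
Qed.

Lemma integral_tiltM m m' :
  (\int[P]_n (tilt m n * tilt m' n)%:E =
   (expR (dot m m' / sigma ^+ 2))%:E)%E.
Proof.
under eq_integral do rewrite tiltD EFinM.
rewrite ge0_integralZl//.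
- by rewrite integral_tilt mule1.
- by apply/measurable_EFinP; exact: measurable_tilt.
- by move=> *; rewrite lee_fin expR_ge0.
Qed.

Lemma sqintegrable_tilt m : sqintegrable P (fun n : cVm R M => tilt m n).
Proof.
split; first exact: measurable_tilt.
under eq_integral do rewrite expr2.
by rewrite integral_tiltM ltry.
Qed.

Lemma inner_tilt m m' : inner P (fun n : cVm R M => tilt m n)
  (fun n : cVm R M => tilt m' n) = expR (dot m m' / sigma ^+ 2).
Proof. by rewrite /inner /Rintegral integral_tiltM. Qed.

Variable x0 : 'cV[R]_N.
Let m0 := H *m x0.

Definition prefactor (x : 'cV[R]_N) : R :=
  expR (dot m0 m0 / (2 * sigma ^+ 2) - dot (H *m x) m0 / sigma ^+ 2).

(** The square root of the density [tilt (m0 + m0)], as [tilt_split0] shows. *)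
Definition halftilt (n : 'cV[R]_M) : R :=
  expR (dot n m0 / sigma ^+ 2 - dot m0 m0 / sigma ^+ 2).

Lemma halftiltE n :
  halftilt n = expR (- (dot m0 m0 / (2 * sigma ^+ 2))) * tilt m0 n.
Proof.
by rewrite /halftilt /tilt -expRD; congr expR; field; rewrite gt_eqF.
Qed.

Lemma tilt_split x n :
  tilt (H *m x + m0) n = prefactor x * halftilt n * tilt (H *m x) n.
Proof.
rewrite /tilt /prefactor /halftilt -!expRD; congr expR.
rewrite !dotDr !dotDl (dotC m0 (H *m x)).
by field; rewrite gt_eqF.
Qed.

Lemma tilt_split0 n : tilt (m0 + m0) n = halftilt n ^+ 2.
Proof.
rewrite /tilt /halftilt [RHS]expr2 -expRD; congr expR; rewrite !dotDr !dotDl.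
by field; rewrite gt_eqF.
Qed.

Lemma sqintegrable_halftilt : sqintegrable P (fun n : cVm R M => halftilt n).
Proof.
have -> : (fun n : cVm R M => halftilt n) = (fun n : cVm R M =>
    expR (- (dot m0 m0 / (2 * sigma ^+ 2))) * tilt m0 n + 0 * tilt m0 n).
  by apply/funext => n; rewrite halftiltE mul0r addr0.
apply: sqintegrable_lin; exact: sqintegrable_tilt.
Qed.

(* Recentring at [- m0] makes the second moment at [x0] the squared norm of the
   recentred estimator, and the mean at [x] its pairing with [tilt (H x)]. *)
Definition recenter (gh : 'cV[R]_M -> R) (n : 'cV[R]_M) : R :=
  gh (- m0 + n) * halftilt n.

(** The shift by [H x] is split into a recentring by [- m0] and a Cameron-Martin shift by
    [H x + m0]. *)
Lemma gexpE x (F : cVm R M -> \bar R) :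
  measurable_fun setT F -> (forall v, 0 <= F v)%E ->
  (gexp H sigma x F =
   \int[P]_n (F (- m0 + (n : 'cV[R]_M))%R * (tilt (H *m x + m0) n)%:E))%E.
Proof.
move=> mF F0; rewrite /gexp.
have mF' := measurableT_comp mF (measurable_addl (H *m x)).
have [-> _] := PE mF' (fun v => F0 _).
have mF0 := measurableT_comp mF (measurable_addl (- m0)).
have [_ /(_ (H *m x + m0)) <-] := PE mF0 (fun v => F0 _).
apply: eq_integral => n _ /=; congr F.
by rewrite !addrA (addrC (- m0)) subrK.
Qed.

(** At [x0] the density is [halftilt^2], so the variance is the squared norm of
    [recenter gh - e * halftilt]. As [halftilt] is square integrable, finiteness is that of
    [recenter gh], whatever real number [e] is. *)
Lemma gvar_recenter gh : measurable_fun setT (gh : cVm R M -> R) ->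
  (gvar H sigma x0 gh < +oo)%E <-> sqintegrable P (recenter gh : cVm R M -> R).
Proof.
move=> mgh; rewrite /gvar; set e := gmean _ _ _ _.
have mr : measurable_fun setT (recenter gh : cVm R M -> R).
  apply: measurable_funM; first exact: (measurableT_comp mgh (measurable_addl _)).
  by case: sqintegrable_halftilt.
rewrite gexpE; last 2 first.
- by apply/measurable_EFinP; apply: measurable_funX; apply: measurable_funB.
- by move=> v; rewrite lee_fin sqr_ge0.
pose f (n : cVm R M) := 1 * recenter gh n + (- e) * halftilt n.
rewrite (_ : (\int[P]_n _)%E = (\int[P]_n (f n ^+ 2)%:E)%E); last first.
  apply: eq_integral => n _; rewrite -EFinM tilt_split0 /f /recenter.
  by congr EFin; ring.
split=> [fy|r2]; last first.
  have [] := sqintegrable_lin 1 (- e) r2 sqintegrable_halftilt.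
  by [].
have f2 : sqintegrable P f.
  split=> //; apply: measurable_funD; apply: measurable_funM => //.
  by case: sqintegrable_halftilt.
have -> : (recenter gh : cVm R M -> R) =
    fun n => 1 * f n + e * halftilt (n : 'cV[R]_M).
  by apply/funext => n; rewrite /f; ring.
exact: sqintegrable_lin f2 sqintegrable_halftilt.
Qed.

(** By [tilt_split] the density at [x] is [prefactor x * halftilt * tilt (H x)], and [recenter]
    absorbs [halftilt]. *)
Lemma gmean_recenter gh x : measurable_fun setT (gh : cVm R M -> R) ->
  sqintegrable P (recenter gh : cVm R M -> R) ->
  integrable_at H sigma x gh /\
  gmean H sigma x gh = prefactor x *
    inner P (recenter gh : cVm R M -> R) (fun n : cVm R M => tilt (H *m x) n).
Proof.
move=> mgh r2.
have t2 := sqintegrable_tilt (H *m x).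
pose f (n : cVm R M) := prefactor x * (recenter gh n * tilt (H *m x) n).
have intf : P.-integrable setT (EFin \o f).
  exact: (integrableZl measurableT (prefactor x) (sqintegrableM r2 t2)).
have fE n : prefactor x * (recenter gh n * tilt (H *m x) n) =
    gh (- m0 + n) * tilt (H *m x + m0) n.
  by rewrite tilt_split /recenter; ring.
have t0 (n : 'cV[R]_M) : 0 <= tilt (H *m x + m0) n by exact: expR_ge0.
split.
  rewrite /integrable_at gexpE; last 2 first.
  - by apply/measurable_EFinP; exact: measurableT_comp.
  - by move=> v; rewrite lee_fin.
  have /integrableP[_] := intf; congr (_ < _)%E; apply: eq_integral => n _ /=.
  by rewrite -EFinM /f fE normrM (ger0_norm (t0 n)).
have max0 (a b : R) : 0 <= b -> Num.max a 0 * b = Num.max (a * b) 0.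
  by move=> b0; rewrite maxr_pMl// mul0r.
rewrite /inner -RintegralZl//; last exact: sqintegrableM.
rewrite -Rintegral_maxB// /gmean.
have mp : measurable_fun setT (fun v : cVm R M => (Num.max (gh v) 0)%:E).
  by apply/measurable_EFinP; exact: measurable_maxr.
have mn : measurable_fun setT (fun v : cVm R M => (Num.max (- gh v) 0)%:E).
  apply/measurable_EFinP; apply: measurable_maxr => //.
  exact: measurableT_comp.
have m0r (a : R) : (0 <= (Num.max a 0)%:E)%E.
  by rewrite lee_fin le_max lexx orbT.
rewrite (gexpE _ mp)// (gexpE _ mn)//.
by congr (fine _ - fine _); apply: eq_integral => n _;
  rewrite -EFinM max0// fE ?mulNr.
Qed.

Lemma valid_biasE S (g c : 'cV[R]_N -> R) :
  valid_bias H sigma S g c x0 <->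
  exists2 k : cVm R M -> R, sqintegrable P k &
    forall x, XS N S x ->
      c x = prefactor x * inner P k (fun n : cVm R M => tilt (H *m x) n) - g x.
Proof.
split=> [[gh [egh _ vgh bgh]]|[k k2 ck]].
  have mgh : measurable_fun setT (gh : cVm R M -> R).
    by move=> _ B mB; rewrite setTI; exact: egh.
  have r2 := (gvar_recenter mgh).1 vgh.
  exists (recenter gh) => // x /bgh[_ <-].
  by rewrite /bias; have [_ ->] := gmean_recenter x mgh r2.
(* The inverse of [recenter], available because [halftilt] is an exponential. *)
pose gh (y : 'cV[R]_M) := k (m0 + y) / halftilt (m0 + y).
have mgh : measurable_fun setT (gh : cVm R M -> R).
  have [mk _] := k2.
  apply: measurable_funM; first exact: (measurableT_comp mk (measurable_addl m0)).
  rewrite /halftilt; under eq_fun do rewrite -expRN.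
  apply: measurableT_comp => //; apply: measurableT_comp => //.
  apply: measurable_funB => //; apply: measurable_funM => //.
  rewrite /dot; under eq_fun do rewrite -/(dot _ _) dotE.
  apply: measurable_sum => i; apply: measurable_funM => //.
  exact: (measurableT_comp (measurable_coord i) (measurable_addl m0)).
have rk : (recenter gh : cVm R M -> R) = k.
  apply/funext => n; rewrite /recenter /gh addrA subrr add0r divfK//.
  by rewrite expR_eq0.
have r2 : sqintegrable P (recenter gh : cVm R M -> R) by rewrite rk.
exists gh; split.
- by move=> B mB; have := mgh measurableT _ mB; rewrite setTI.
- by have [] := gmean_recenter x0 mgh r2.
- exact/gvar_recenter.
- move=> x xS; have [ix mx] := gmean_recenter x mgh r2.
  by split=> //; rewrite /bias mx rk ck.
Qed.

End gaussian_estimation.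

(** * Power series in several variables *)

Section multi_index_sums.
Variables (R : realType) (D : nat).
Local Notation mindex := (mindex D).
Local Notation cnt := (@counting nat R).
Implicit Types (f a : mindex -> R) (t : 'I_D -> R).

(* Families over multi-indices become functions on [nat] through the
   enumeration [pickle], extended by [0]. *)
Definition natext f (n : nat) : R :=
  if pickle_inv n is Some p then f p else 0.

Lemma measurable_fun_nat d' (T : measurableType d') (h : nat -> T) :
  measurable_fun setT h.
Proof. by []. Qed.

Lemma natext_pickle f p : natext f (pickle p) = f p.
Proof. by rewrite /natext pickleK_inv. Qed.

Lemma natext_map (op : R -> R) f n : op 0 = 0 ->
  natext (fun p => op (f p)) n = op (natext f n).
Proof. by move=> op0; rewrite /natext; case: pickle_inv. Qed.

Lemma esum_natext f : (forall p, 0 <= f p) ->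
  (\esum_(p in [set: mindex]) (f p)%:E = \int[cnt]_n (natext f n)%:E)%E.
Proof.
move=> f0.
have n0 n : (0 <= (natext f n)%:E)%E.
  by rewrite lee_fin /natext; case: pickle_inv.
rewrite ge0_integral_count// nneseries_esumT//.
transitivity (\esum_(n in range (@pickle mindex)) (natext f n)%:E)%E.
  rewrite (reindex_esum setT (range (@pickle mindex)) (@pickle mindex)).
    by apply: eq_esum => p _; rewrite natext_pickle.
  split; first by move=> p _; exists p.
    by move=> p q _ _; exact: (pcan_inj pickleK_inv).
  by move=> n [p _ <-]; exists p.
rewrite esum_mkcond; apply: eq_esum => n _.
case: ifPn => // nr; rewrite /natext; case E: (pickle_inv n) => [p|//].
have := @pickle_invK mindex n; rewrite /oapp E => En.
by move: nr; rewrite -En mem_set//; exists p.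
Qed.

Lemma multisum_natext f : (cnt : {measure set nat -> \bar R}).-integrable setT
    (EFin \o natext f) ->
  multisum f = \int[cnt]_n natext f n.
Proof.
move=> intf; rewrite -Rintegral_maxB// /multisum !esum_natext; first last.
- by move=> p; rewrite le_max lexx orbT.
- by move=> p; rewrite le_max lexx orbT.
congr (fine _ - fine _); apply: eq_integral => n _; congr EFin.
  by rewrite (natext_map (op := fun r => Num.max r 0))// maxxx.
by rewrite (natext_map (op := fun r => Num.max (- r) 0))// oppr0 maxxx.
Qed.

Lemma l2seq_natext a : l2seq a <-> sqintegrable cnt (natext a).
Proof.
rewrite /l2seq esum_natext; last by move=> p; rewrite sqr_ge0.
rewrite /sqintegrable; split=> [h|[_]].
  split; first exact: measurable_fun_nat.
  by under eq_integral do rewrite -(natext_map (op := fun r => r ^+ 2)) ?expr0n//.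
by under eq_integral do rewrite -(natext_map (op := fun r => r ^+ 2)) ?expr0n//.
Qed.

(** Restriction to the codes of multi-indices only drops nonnegative terms. *)
Lemma sqintegrable_pickle (k : nat -> R) : sqintegrable cnt k ->
  l2seq (fun p : mindex => k (pickle p)).
Proof.
move=> [_ ky]; rewrite /l2seq esum_natext; last by move=> p; rewrite sqr_ge0.
apply: le_lt_trans ky; apply: ge0_le_integral => //.
- move=> n _; rewrite lee_fin /natext; case: pickle_inv => // p.
  by rewrite sqr_ge0.
- move=> n _; rewrite lee_fin /natext; case E: (pickle_inv n) => [p|].
    by have := @pickle_invK mindex n; rewrite /oapp E => ->.
  by rewrite sqr_ge0.
Qed.

Definition expterm (t : 'I_D -> R) (p : mindex) : R :=
  \prod_i (t i ^+ p i / (p i)`!%:R).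

(** Truncation to a cube of multi-indices, over which the sum factors into one-variable partial sums
    of exponential series. *)
Definition boxterm (t : 'I_D -> R) n (p : mindex) : R :=
  if [forall i, (p i < n)%N] then expterm t p else 0.

Lemma integral_boxterm t n :
  (\int[cnt]_k (natext (boxterm t n) k)%:E =
   (\prod_i series (exp_coeff (t i)) n)%:E)%E.
Proof.
pose toidx (q : {ffun 'I_D -> 'I_n}) : mindex := [ffun i => q i : nat].
have toidx_inj : injective toidx.
  move=> q q' /ffunP qq'; apply/ffunP => i; apply: ord_inj.
  by have := qq' i; rewrite !ffunE.
(* A finite sum of point masses, one for each multi-index in the cube, can be integrated
   termwise. *)
have natboxE k : natext (boxterm t n) k =
    \sum_(q : {ffun 'I_D -> 'I_n})
      expterm t (toidx q) * \1_[set pickle (toidx q)] k.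
  rewrite /natext; case E: (pickle_inv k) => [p|]; last first.
    rewrite big1// => q _; rewrite indicE memNset ?mulr0// => /= kq.
    by move: E; rewrite kq pickleK_inv.
  have Ek : pickle p = k by have := @pickle_invK mindex k; rewrite /oapp E.
  have indE q : \1_[set pickle (toidx q)] k = (p == toidx q)%:R :> R.
    rewrite indicE; congr (_%:R); congr nat_of_bool; apply/idP/eqP.
      rewrite inE/= -Ek => H; exact: (pcan_inj pickleK_inv H).
    by move=> <-; rewrite inE/=.
  rewrite /boxterm; case: ifPn => [/forallP pn|pn].
    pose q0 : {ffun 'I_D -> 'I_n} := [ffun i => Ordinal (pn i)].
    have q0p : toidx q0 = p by apply/ffunP => i; rewrite !ffunE.
    rewrite (bigD1 q0)//= indE q0p eqxx mulr1 big1 ?addr0// => q qq0.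
    rewrite indE; case: eqP => [pq|]; last by rewrite mulr0.
    by move: qq0; rewrite -q0p in pq; rewrite (toidx_inj _ _ pq) eqxx.
  rewrite big1// => q _; rewrite indE; case: eqP => [pq|]; last by rewrite mulr0.
  by case/forallP: pn => i; rewrite pq ffunE.
have cnt1 m : cnt [set m] = 1%E.
  rewrite /counting asboolT; last exact: finite_set1.
  by rewrite fset_set1 finmap.cardfs1.
have int1 q : (cnt : {measure set nat -> \bar R}).-integrable setT
    (fun k => ((expterm t (toidx q))%:E * (\1_[set pickle (toidx q)] k)%:E)%E).
  apply: (@integrableZl _ _ _ _ _ measurableT
    (expterm t (toidx q)) (fun k => (\1_[set pickle (toidx q)] k)%:E)).
  apply/integrableP; split=> //.
  under eq_integral do rewrite /= ger0_norm//.
  by rewrite integral_indic// setIT [X in (X < _)%E]cnt1 ltry.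
under eq_integral => k _.
  rewrite natboxE -sumEFin; under eq_bigr do rewrite EFinM; over.
rewrite (integral_sum measurableT int1).
transitivity (\sum_(q : {ffun 'I_D -> 'I_n}) (expterm t (toidx q))%:E)%E.
  apply: eq_bigr => q _; rewrite integralZl//; last first.
    apply/integrableP; split=> //.
    under eq_integral do rewrite /= ger0_norm//.
    by rewrite integral_indic// setIT [X in (X < _)%E]cnt1 ltry.
  by rewrite integral_indic// setIT [X in (_ * X)%E]cnt1 mule1.
rewrite sumEFin; congr EFin; rewrite /expterm.
under [RHS]eq_bigr do rewrite /series/= big_mkord.
rewrite bigA_distr_bigA/=; apply: eq_bigr => q _; apply: eq_bigr => i _.
by rewrite ffunE.
Qed.

Lemma cvg_prod_series t :
  (fun n => \prod_i series (exp_coeff (t i)) n) @ \oo -->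
  expR (\sum_(i < D) t i).
Proof.
rewrite expR_sum; elim: (index_enum _) => [|i s IH].
  by rewrite big_nil; under eq_fun do rewrite big_nil; exact: cvg_cst.
rewrite big_cons; under eq_fun do rewrite big_cons.
by apply: cvgM => //; exact: is_cvg_series_exp_coeff.
Qed.

Lemma cvg_boxterm t k :
  ((natext (boxterm t n) k)%:E) @[n --> \oo] --> ((natext (expterm t) k)%:E).
Proof.
apply: cvg_EFin; first exact: nearW.
rewrite /natext; case: pickle_inv => [p|]; last exact: cvg_cst.
(* From this [n] on, [p] lies in the cube and the sequence is constant. *)
apply: cvg_near_cst; exists (\max_i p i).+1 => // n /= pn.
rewrite /boxterm ifT//; apply/forallP => i.
by apply: leq_trans pn; rewrite ltnS; exact: leq_bigmax.
Qed.

Lemma expterm_ge0 t p : (forall i, 0 <= t i) -> 0 <= expterm t p.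
Proof. by move=> t0; apply: prodr_ge0 => i _; rewrite divr_ge0// exprn_ge0. Qed.

Lemma integral_expterm t : (forall i, 0 <= t i) ->
  (\int[cnt]_k (natext (expterm t) k)%:E = (expR (\sum_(i < D) t i))%:E)%E.
Proof.
move=> t0.
have -> : (\int[cnt]_k (natext (expterm t) k)%:E =
    \int[cnt]_k limn (fun n => (natext (boxterm t n) k)%:E))%E.
  apply: eq_integral => k _; apply/esym/cvg_lim => //; exact: cvg_boxterm.
rewrite monotone_convergence//.
- apply/cvg_lim => //; under eq_fun do rewrite integral_boxterm.
  by apply: cvg_EFin; [exact: nearW|exact: cvg_prod_series].
- move=> n k _; rewrite lee_fin /natext /boxterm; case: pickle_inv => // p.
  by case: ifP => // _; exact: expterm_ge0.
- move=> k _ m n mn; rewrite lee_fin /natext /boxterm.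
  case: pickle_inv => // p; case: ifPn => [/forallP pm|_].
    by rewrite ifT//; apply/forallP => i; exact: leq_trans (pm i) mn.
  by case: ifP => // _; exact: expterm_ge0.
Qed.

(** For arbitrary signs, dominated convergence replaces monotone convergence; the dominating terms
    come from the nonnegative case at the absolute values of [t]. *)
Lemma Rintegral_expterm t :
  \int[cnt]_k natext (expterm t) k = expR (\sum_(i < D) t i).
Proof.
pose u i := `|t i|.
have u0 i : 0 <= u i by exact: normr_ge0.
have intu : (cnt : {measure set nat -> \bar R}).-integrable setT
    (fun k => (natext (expterm u) k)%:E).
  apply/integrableP; split=> //.
  have -> : (\int[cnt]_k `|(natext (expterm u) k)%:E| =
      \int[cnt]_k (natext (expterm u) k)%:E)%E.
    apply: eq_integral => k _; rewrite gee0_abs// lee_fin /natext.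
    by case: pickle_inv => // p; exact: expterm_ge0.
  by rewrite integral_expterm// ltry.
have box_cvg : {ae cnt, forall k, [set: nat] k ->
    (natext (boxterm t n) k)%:E @[n --> \oo] --> (natext (expterm t) k)%:E}.
  by apply: aeW => k _; exact: cvg_boxterm.
have box_le : {ae cnt, forall k n, [set: nat] k ->
    (`|(natext (boxterm t n) k)%:E| <= (natext (expterm u) k)%:E)%E}.
  apply: aeW => k n _; rewrite lee_fin /natext.
  case: pickle_inv => [p|]; last by rewrite normr0.
  rewrite /boxterm; case: ifP => _; last by rewrite normr0 expterm_ge0.
  rewrite /expterm normr_prod; apply: ler_prod => i _.
  by rewrite normr_ge0/= normrM normrX normfV (ger0_norm (ler0n _ _)).
have [_ _ cvgI] := dominated_convergence measurableT
  (fun n => measurable_fun_nat _) (measurable_fun_nat _) box_cvg intu box_le.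
rewrite /Rintegral -(cvg_lim _ cvgI)//.
under eq_fun do rewrite integral_boxterm.
suff /cvg_lim-> : (\prod_i series (exp_coeff (t i)) n)%:E @[n --> \oo] -->
  (expR (\sum_(i < D) t i))%:E by [].
by apply: cvg_EFin; [exact: nearW|exact: cvg_prod_series].
Qed.

(** The feature vector in [l^2] of the exponential kernel [exp <z, z'>]. *)
Definition monomial (z : 'cV[R]_D) (p : mindex) : R :=
  mpow z p / Num.sqrt (mfact p).

Lemma monomialM z z' p :
  monomial z p * monomial z' p = expterm (fun i => z i 0 * z' i 0) p.
Proof.
rewrite /monomial mulrACA -invfM -expr2 sqr_sqrtr ?ler0n//.
rewrite /expterm big_split/= prodfV /mpow -big_split/=; congr (_ / _).
  by apply: eq_bigr => i _; rewrite exprMn.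
by rewrite /mfact natr_prod.
Qed.

Lemma sqintegrable_monomial z : sqintegrable cnt (natext (monomial z)).
Proof.
split; first exact: measurable_fun_nat.
under eq_integral => n _.
  rewrite -(natext_map (op := fun r => r ^+ 2)) ?expr0n//.
  rewrite (_ : (fun p => monomial z p ^+ 2) =
    expterm (fun i => z i 0 * z i 0)); last first.
    by apply/funext => p; rewrite expr2 monomialM.
  over.
by rewrite integral_expterm ?ltry// => i; rewrite -expr2 sqr_ge0.
Qed.

Lemma inner_monomial z z' :
  inner cnt (natext (monomial z)) (natext (monomial z')) = expR (dot z z').
Proof.
rewrite dotE -Rintegral_expterm /inner; apply: eq_Rintegral => n _.
rewrite /natext; case: pickle_inv => [p|]; last by rewrite mulr0.
by rewrite monomialM.
Qed.

Lemma multisum_monomial a z : l2seq a ->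
  multisum (fun p => a p / Num.sqrt (mfact p) * mpow z p) =
  inner cnt (natext a) (natext (monomial z)).
Proof.
move=> /l2seq_natext a2.
have aE n : natext (fun p => a p / Num.sqrt (mfact p) * mpow z p) n =
    natext a n * natext (monomial z) n.
  rewrite /natext; case: pickle_inv => [p|]; last by rewrite mulr0.
  by rewrite /monomial mulrAC mulrA.
have int_az := sqintegrableM a2 (sqintegrable_monomial z).
rewrite multisum_natext; last first.
  by apply: eq_integrable int_az => // n _; rewrite /= aE.
by apply: eq_Rintegral => n _; rewrite aE.
Qed.

Lemma multisum_representation (Z : Type) (zeta : Z -> 'cV[R]_D) (F : Z -> R) :
  (exists2 a, l2seq a & forall x,
    F x = multisum (fun p => a p / Num.sqrt (mfact p) * mpow (zeta x) p)) <->
  (exists2 k, sqintegrable cnt k & forall x,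
    F x = inner cnt k (natext (monomial (zeta x)))).
Proof.
split=> [[a a2 aF]|[k k2 kF]].
  exists (natext a); first exact/l2seq_natext.
  by move=> x; rewrite aF multisum_monomial.
(* Dropping the values of [k] off the codes keeps the pairing, since [natext (monomial z)] vanishes
   there. *)
have a2 := sqintegrable_pickle k2; exists (fun p => k (pickle p)) => // x.
rewrite kF multisum_monomial//; apply: eq_Rintegral => n _.
rewrite /natext; case E: (pickle_inv n) => [p|]; last by rewrite !mulr0.
by have := @pickle_invK mindex n; rewrite /oapp E => ->.
Qed.

End multi_index_sums.

(** * The singular value decomposition *)

Section pseudoinverse.
Variable R : realType.

(** Uniqueness makes any matrix satisfying the Penrose equations the value chosen by [mpinv]. Since
    [A X = (A Y) (A X)], transposing the product of symmetric factors gives [A Y]; likewise on the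
    other side. *)
Lemma penrose_uniq m n (A : 'M[R]_(m, n)) X Y :
  penrose A X -> penrose A Y -> X = Y.
Proof.
move=> [aX xX sX tX] [aY xY sY tY].
have AXY : A *m X = A *m Y.
  transitivity ((A *m Y) *m (A *m X)); first by rewrite mulmxA aY.
  by rewrite -{1}sY -{1}sX -trmx_mul mulmxA aX.
have XAY : X *m A = Y *m A.
  transitivity ((X *m A) *m (Y *m A)); first by rewrite -mulmxA (mulmxA A) aY.
  by rewrite -{1}tX -{1}tY -trmx_mul -mulmxA (mulmxA A) aX.
by rewrite -xX -mulmxA AXY mulmxA XAY.
Qed.

End pseudoinverse.

Section thin_svd.
Variables (R : realType) (M N D : nat).
Variables (U : 'M[R]_(M, D)) (Sig : 'M[R]_D) (V : 'M[R]_(N, D)).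
Hypothesis UU : U^T *m U = 1%:M.
Hypothesis VV : V^T *m V = 1%:M.
Hypothesis Sig_diag : forall i j : 'I_D, i != j -> Sig i j = 0.
Hypothesis Sig_gt0 : forall i : 'I_D, 0 < Sig i i.

Lemma Sig_unit : Sig \in unitmx.
Proof.
have -> : Sig = diag_mx (\row_i Sig i i).
  apply/matrixP => i j; rewrite !mxE; have [->|ij] := eqVneq i j.
    by rewrite mulr1n.
  by rewrite Sig_diag// mulr0n.
rewrite unitmxE det_diag unitfE; apply/prodf_neq0 => i _.
by rewrite mxE gt_eqF.
Qed.

(** [Sig V^T] is a left inverse, and the product in the other order is the symmetric projection
    [V V^T]. *)
Lemma mpinv_svd : mpinv (V *m invmx Sig) = Sig *m V^T.
Proof.
have pen : penrose (V *m invmx Sig) (Sig *m V^T).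
  have AX : V *m invmx Sig *m (Sig *m V^T) = V *m V^T.
    by rewrite mulmxA mulmxKV ?Sig_unit.
  have XA : Sig *m V^T *m (V *m invmx Sig) = 1%:M.
    by rewrite mulmxA -(mulmxA Sig) VV mulmx1 mulmxV ?Sig_unit.
  split.
  - by rewrite -mulmxA XA mulmx1.
  - by rewrite XA mul1mx.
  - by rewrite AX trmx_mul trmxK.
  - by rewrite XA trmx1.
by apply: (penrose_uniq _ pen); apply: (xgetPex 0); exists (Sig *m V^T).
Qed.

(** The match of the two Gram kernels: [U] preserves inner products, which leaves [Sig V^T] on both
    sides. *)
Lemma dot_svd (sigma : R) (x x' : 'cV[R]_N) :
  dot (sigma^-1 *: (mpinv (V *m invmx Sig) *m x))
      (sigma^-1 *: (mpinv (V *m invmx Sig) *m x')) =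
  dot (U *m Sig *m V^T *m x) (U *m Sig *m V^T *m x') / sigma ^+ 2.
Proof.
have dotU u v : dot (U *m u) (U *m v) = dot u v.
  by rewrite /dot trmx_mul -mulmxA (mulmxA U^T) UU mul1mx.
rewrite mpinv_svd -!(mulmxA U) dotU !dotE big_distrl/=; apply: eq_bigr => i _.
by rewrite !mxE mulrACA -invfM -expr2 mulrC.
Qed.

End thin_svd.

(** * Comparison of the two families of vectors *)

Unset Implicit Arguments.

Theorem theorem4 (R : realType) (M N S : nat) (H : 'M[R]_(M, N)) (sigma : R)
    (g : 'cV[R]_N -> R) (x0 : 'cV[R]_N)
    (D : nat) (U : 'M[R]_(M, D)) (Sig : 'M[R]_D) (V : 'M[R]_(N, D))
    (c : 'cV[R]_N -> R) :
  (1 <= S <= N)%N ->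
  (S < spark H)%N ->
  0 < sigma ->
  XS N S x0 ->
  D = \rank H ->
  U^T *m U = 1%:M ->
  V^T *m V = 1%:M ->
  (forall i j : 'I_D, i != j -> Sig i j = 0) ->
  (forall i : 'I_D, 0 < Sig i i) ->
  H = U *m Sig *m V^T ->
  let Ht := V *m invmx Sig in
  valid_bias H sigma S g c x0 <->
  exists a : mindex D -> R, l2seq a /\
    forall x, XS N S x ->
      c x = expR ((2 * sigma ^+ 2)^-1 * ((H *m x0)^T *m (H *m x0)) 0 0
                  - (sigma ^+ 2)^-1 * (x^T *m H^T *m H *m x0) 0 0)
            * multisum (fun p : mindex D => a p / Num.sqrt (mfact p)
                             * mpow (sigma^-1 *: (mpinv Ht *m x)) p)
            - g x.
Proof.
move=> _ _ sigma_gt0 _ _ UU VV Sig_diag Sig_gt0 HE Ht.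
have [P PE] := giter_gaussian M sigma_gt0.
(* Indexing by the sparse vectors alone imposes the representation exactly on the parameter set. *)
pose Z := {x : 'cV[R]_N | XS N S x}.
pose zeta (x : 'cV[R]_N) := sigma^-1 *: (mpinv Ht *m x).
(* The bias formula solved for the pairing. *)
pose F (x : Z) := (c (sval x) + g (sval x)) / prefactor H sigma x0 (sval x).
have FE x (Sx : XS N S x) (r : R) :
    c x = prefactor H sigma x0 x * r - g x <-> F (exist _ x Sx) = r.
  have pre0 : prefactor H sigma x0 x != 0 by rewrite expR_eq0.
  rewrite /F /=; split=> [->|<-]; first by rewrite subrK mulrC mulKf.
  by rewrite mulrC divfK// addrK.
have preE x : prefactor H sigma x0 x =
    expR ((2 * sigma ^+ 2)^-1 * ((H *m x0)^T *m (H *m x0)) 0 0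
          - (sigma ^+ 2)^-1 * (x^T *m H^T *m H *m x0) 0 0).
  rewrite /prefactor /dot [(H *m x)^T]trmx_mul !mulmxA.
  by congr (expR (_ - _)); rewrite mulrC.
have kernelE (x y : Z) : inner (@counting nat R)
    (natext (monomial (zeta (sval x)))) (natext (monomial (zeta (sval y)))) =
    expR (dot (H *m sval x) (H *m sval y) / sigma ^+ 2).
  by rewrite inner_monomial /zeta (dot_svd UU)// -HE.
have := representer (fun x : Z => sqintegrable_tilt sigma_gt0 PE (H *m sval x))
  (fun x y => inner_tilt sigma_gt0 PE (H *m sval x) (H *m sval y)) F.
have := representer
  (fun x : Z => sqintegrable_monomial (zeta (sval x))) kernelE F.
(* Both families yield the same Gram bound on [F]; eliminating it identifies pairings in [L^2] of
   the noise law with pairings in [l^2]. *)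
move=> <- RP.
have RM := multisum_representation (fun x : Z => zeta (sval x)) F.
have RV := valid_biasE H sigma_gt0 PE x0 S g c.
split=> [/RV[k k2 ck]|[a [a2 ca]]].
  have [|a a2 aF] := RM.2 (RP.1 _).
    by exists k => // -[x Sx]; exact/FE/ck.
  by exists a; split=> // x Sx; rewrite -preE; exact/FE/(aF (exist _ x Sx)).
apply/RV; have [|k k2 kF] := RP.2 (RM.1 _).
  by exists a => // -[x Sx]; apply/FE; rewrite preE ca.
by exists k => // x Sx; exact/FE/(kF (exist _ x Sx)).
Qed.
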